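(* Let $(\mathcal{P}=\bigoplus_{n\in\mathbb{N}}\mathcal{P}_n,\{.,.\})$ be an $\mathbb{N}$-graded Poisson algebra over a field $\mathbb{K}$ of characteristic $0$ and let $(y_1,\ldots,y_m)$ be a Poisson cluster of $\mathcal{P}$ consisting of homogeneous elements of positive degrees, with $\{y_j,y_k\}=\lambda_{jk}y_jy_k$. Let $\Omega\colon\mathbb{Z}^m\times\mathbb{Z}^m\to\mathbb{K}$ be the skewsymmetric additive bicharacter with $\Omega(\delta_j,\delta_k)=\lambda_{jk}$, where $\delta_1,\dots,\delta_m$ is the standard basis of $\mathbb{Z}^m$. Then there is a group embedding $$\iota\colon\operatorname{UAut}(\mathcal{P},\{.,.\})\hookrightarrow\operatorname{Aut}(\mathbb{K}(T),\{.,.\}_\Omega)$$ whose image is contained in the set of unipotent bi-integral automorphisms of $(\mathbb{K}(T),\{.,.\}_\Omega)$. For $\phi\in\operatorname{UAut}(\mathcal{P},\{.,.\})$, $\iota(\phi)$ is the unique automorphism of $(\mathbb{K}(T),\{.,.\}_\Omega)$ such that $\iota(\phi)|_{\mathcal{P}}=\phi$.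
   Context: $\mathbb{N}=\{0,1,\ldots\}$. In an $\mathbb{N}$-graded Poisson algebra the Poisson bracket is assumed to be graded, but not necessarily of degree $0$. An $m$-tuple $(y_1,\ldots,y_m)$ of elements of a (commutative) Poisson algebra $\mathcal{P}$ over $\mathbb{K}$ is a Poisson cluster if (1) $\{y_j,y_k\}=\lambda_{jk}y_jy_k$ for all $j,k$, for some $\lambda_{jk}\in\mathbb{K}$; (2) $y_1,\ldots,y_m$ generate a polynomial subalgebra of $\mathcal{P}$ (i.e. are algebraically independent); (3) $\mathcal{P}$ is contained in the localization $\mathbb{K}[y_1^{\pm1},\ldots,y_m^{\pm1}]$. Then $\mathbb{K}[y_1,\ldots,y_m]\subseteq\mathcal{P}\subseteq\mathbb{K}[y_1^{\pm1},\ldots,y_m^{\pm1}]$ are embeddings of Poisson algebras, the bracket on the last algebra being the canonical extension. $\operatorname{UAut}(\mathcal{P},\{.,.\})$ is the group of Poisson automorphisms $\phi$ of $\mathcal{P}$ with $\phi(f)-f\in\mathcal{P}_{\geq n+1}=\bigoplus_{l\ge n+1}\mathcal{P}_l$ for all $n\in\mathbb{N}$, $f\in\mathcal{P}_n$. $\mathbb{K}[T]=\mathbb{K}[y_1^{\pm1},\ldots,y_m^{\pm1}]$, $\mathbb{K}(T)=\mathbb{K}(y_1,\ldots,y_m)$, with Poisson bracket $\{y^\alpha,y^\beta\}_\Omega=\Omega(\alpha,\beta)y^\alpha y^\beta$ ($\alpha,\beta\in\mathbb{Z}^m$), which coincides with the bracket extended from $\mathcal{P}$. $\mathbb{K}[T]$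 is $\mathbb{Z}$-graded by $\deg y_k=d_k$, the degree of $y_k$ in $\mathcal{P}$, and $\mathbb{K}[T]_{>n}$ is the sum of components of degree $>n$. An automorphism $\phi$ of the Poisson field $(\mathbb{K}(T),\{.,.\}_\Omega)$ is bi-integral if $\phi(y_k),\phi^{-1}(y_k)\in\mathbb{K}[T]$ for all $k$; a bi-integral automorphism is unipotent if $\phi(y_k)-y_k\in\mathbb{K}[T]_{>d_k}$ for all $k$. *)

(* Defs.v *)
From HB Require Import structures.
From mathcomp Require Import all_boot all_order all_algebra.
From mathcomp Require Import mpoly boolp ring.

Set Implicit Arguments.
Unset Strict Implicit.
Unset Printing Implicit Defensive.

Import GRing.Theory.
Local Open Scope ring_scope.

(* Skewsymmetry is used in the form {f, g} = - {g, f}; in characteristic 0 this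
   is equivalent to {f, f} = 0.  Linearity and the Leibniz rule in the first
   argument follow. *)
Record poissonBracket (K : fieldType) (A : comAlgType K) := PoissonBracket {
  pbracket :> A -> A -> A;
  pbracket_linear : forall f, linear (pbracket f);
  pbracket_skew : forall f g, pbracket f g = - pbracket g f;
  pbracket_jacobi : forall f g h,
    pbracket f (pbracket g h) + pbracket g (pbracket h f)
      + pbracket h (pbracket f g) = 0;
  pbracket_leibniz : forall f g h,
    pbracket f (g * h) = pbracket f g * h + g * pbracket f h
}.

Section PoissonAutomorphisms.
Variables (K : fieldType) (A : comAlgType K) (B : poissonBracket A).

Record poissonAut := PoissonAut {
  paut_fun :> A -> A;
  paut_linear : linear paut_fun;
  paut_monoid_morphism : monoid_morphism paut_fun;
  paut_bij : bijective paut_fun;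
  paut_bracket : {morph paut_fun : f g / B f g}
}.

Lemma poissonAutP (phi psi : poissonAut) : phi =1 psi -> phi = psi.
Proof.
case: phi psi => [f f1 f2 f3 f4] [g g1 g2 g3 g4] /= /funext fg.
case: _ / fg g1 g2 g3 g4 => *; congr PoissonAut; exact: Prop_irrelevance.
Qed.

HB.instance Definition _ := gen_eqMixin poissonAut.
HB.instance Definition _ := gen_choiceMixin poissonAut.

Fact paut_one_linear : linear (id : A -> A). Proof. by []. Qed.
Fact paut_one_monoid : monoid_morphism (id : A -> A). Proof. by []. Qed.
Fact paut_one_bij : bijective (id : A -> A). Proof. by exists id. Qed.
Fact paut_one_bracket : {morph (id : A -> A) : f g / B f g}. Proof. by []. Qed.

Definition paut_one : poissonAut :=
  PoissonAut paut_one_linear paut_one_monoid paut_one_bij paut_one_bracket.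

Section Product.
Variables phi psi : poissonAut.

Fact paut_mul_linear : linear (phi \o psi).
Proof. by move=> a f g /=; rewrite !paut_linear. Qed.
Fact paut_mul_monoid : monoid_morphism (phi \o psi).
Proof.
case: (paut_monoid_morphism phi) (paut_monoid_morphism psi) => p1 pM [q1 qM].
by split=> [|f g] /=; rewrite ?q1 ?p1 // qM pM.
Qed.
Fact paut_mul_bij : bijective (phi \o psi).
Proof. exact: (bij_comp (paut_bij phi) (paut_bij psi)). Qed.
Fact paut_mul_bracket : {morph phi \o psi : f g / B f g}.
Proof. by move=> f g /=; rewrite !paut_bracket. Qed.

Definition paut_mul : poissonAut :=
  PoissonAut paut_mul_linear paut_mul_monoid paut_mul_bij paut_mul_bracket.
End Product.

Lemma paut_inv_ex (phi : poissonAut) :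
  {g : A -> A | cancel phi g /\ cancel g phi}.
Proof. by apply: cid; case: (paut_bij phi) => g ? ?; exists g. Qed.

Definition paut_invfun (phi : poissonAut) : A -> A := sval (paut_inv_ex phi).

Lemma paut_invK (phi : poissonAut) : cancel phi (paut_invfun phi).
Proof. by case: (svalP (paut_inv_ex phi)). Qed.

Lemma paut_Kinv (phi : poissonAut) : cancel (paut_invfun phi) phi.
Proof. by case: (svalP (paut_inv_ex phi)). Qed.

Section Inverse.
Variable phi : poissonAut.
Let inj : injective phi := can_inj (paut_invK phi).

Fact paut_inv_linear : linear (paut_invfun phi).
Proof. by move=> a f g; apply: inj; rewrite paut_linear !paut_Kinv. Qed.
Fact paut_inv_monoid : monoid_morphism (paut_invfun phi).
Proof.
case: (paut_monoid_morphism phi) => p1 pM.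
by split=> [|f g]; apply: inj; rewrite ?pM !paut_Kinv.
Qed.
Fact paut_inv_bij : bijective (paut_invfun phi).
Proof. by exists phi; [exact: paut_Kinv | exact: paut_invK]. Qed.
Fact paut_inv_bracket : {morph paut_invfun phi : f g / B f g}.
Proof. by move=> f g; apply: inj; rewrite paut_bracket !paut_Kinv. Qed.

Definition paut_inv : poissonAut :=
  PoissonAut paut_inv_linear paut_inv_monoid paut_inv_bij paut_inv_bracket.
End Inverse.

Lemma paut_mulA : associative paut_mul.
Proof. by move=> *; apply: poissonAutP. Qed.
Lemma paut_mul1 : left_id paut_one paut_mul.
Proof. by move=> *; apply: poissonAutP. Qed.
Lemma paut_1mul : right_id paut_one paut_mul.
Proof. by move=> *; apply: poissonAutP. Qed.
Lemma paut_mulV : left_inverse paut_one paut_inv paut_mul.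
Proof. by move=> phi; apply: poissonAutP => f; exact: (paut_invK phi f). Qed.
Lemma paut_Vmul : right_inverse paut_one paut_inv paut_mul.
Proof. by move=> phi; apply: poissonAutP => f; exact: (paut_Kinv phi f). Qed.

HB.instance Definition _ := isGroup.Build poissonAut
  paut_mulA paut_mul1 paut_1mul paut_mulV paut_Vmul.

End PoissonAutomorphisms.

Arguments poissonAut {K A} B.

Section Gradings.
Variables (K : fieldType) (A : comAlgType K).

(* The components of an N-grading, extended by 0 to negative degrees. *)
Definition int_component (G : nat -> A -> Prop) (n : int) (f : A) : Prop :=
  if n is Posz k then G k f else f = 0.

Record poissonGrading (B : poissonBracket A) := PoissonGrading {
  component :> nat -> A -> Prop;
  component0 : forall n, component n 0;
  component_linear : forall n a f g,
    component n f -> component n g -> component n (a *: f + g);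
  component_span : forall f, exists N, exists c : nat -> A,
    (forall n, component n (c n)) /\ f = \sum_(n < N) c n;
  component_direct : forall N (c : nat -> A),
    (forall n, component n (c n)) -> \sum_(n < N) c n = 0 ->
    forall n, (n < N)%N -> c n = 0;
  component1 : component 0 1;
  componentM : forall i j f g,
    component i f -> component j g -> component (i + j) (f * g);
  component_bracket : exists r : int, forall i j f g,
    component i f -> component j g ->
    int_component component (i%:Z + j%:Z + r) (B f g)
}.

Variables (B : poissonBracket A) (G : poissonGrading B).

Definition component_ge (n : nat) (f : A) : Prop :=
  exists N, exists c : nat -> A,
    (forall k, G k (c k)) /\ f = \sum_(n <= k < N) c k.

Definition is_unipotent (phi : poissonAut B) : Prop :=
  forall n f, G n f -> component_ge n.+1 (phi f - f).

Lemma component_ge_homog n f : G n f -> component_ge n f.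
Proof.
move=> Gf; exists n.+1, (fun k => if k == n then f else 0); split=> [k|].
  by case: eqP => [->|_] //; apply: component0.
by rewrite big_nat1 eqxx.
Qed.

Lemma component_ge0 n : component_ge n 0.
Proof. exact/component_ge_homog/component0. Qed.

Lemma componentD n f g : G n f -> G n g -> G n (f + g).
Proof. by move=> Gf Gg; rewrite -[f]scale1r; apply: component_linear. Qed.

Lemma componentN n f : G n f -> G n (- f).
Proof.
by move=> Gf; rewrite -scaleN1r -[_ *: _]addr0; apply: component_linear => //;
  apply: component0.
Qed.

Lemma component_ge_pad n f : component_ge n f ->
  exists N, forall N', (N <= N')%N -> exists c : nat -> A,
    (forall k, G k (c k)) /\ f = \sum_(n <= k < N') c k.
Proof.
case=> N [c [Gc ->]]; exists N => N' NN'.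
exists (fun k => if (k < N)%N then c k else 0); split=> [k|].
  by case: ifP => // _; apply: component0.
have [Nn|nN] := leqP N n.
  rewrite big_geq // big_nat_cond big1 // => k /andP[/andP[nk _] _].
  by rewrite ltnNge (leq_trans Nn nk).
rewrite (big_cat_nat (ltnW nN) NN') /= -[LHS]addr0; congr (_ + _).
  by apply: eq_big_nat => k /andP[_ ->].
by rewrite big_nat_cond big1 // => k /andP[/andP[Nk _] _]; rewrite ltnNge Nk.
Qed.

Lemma component_geD n f g :
  component_ge n f -> component_ge n g -> component_ge n (f + g).
Proof.
move=> /component_ge_pad[N1 H1] /component_ge_pad[N2 H2].
have [c1 [G1 ->]] := H1 _ (leq_maxl N1 N2).
have [c2 [G2 ->]] := H2 _ (leq_maxr N1 N2).
exists (maxn N1 N2), (fun k => c1 k + c2 k); split=> [k|].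
  exact: componentD.
by rewrite big_split.
Qed.

Lemma component_geN n f : component_ge n f -> component_ge n (- f).
Proof.
move=> [N [c [Gc ->]]]; exists N, (fun k => - c k); split=> [k|].
  exact: componentN.
by rewrite sumrN.
Qed.

Lemma component_geS n f : component_ge n.+1 f -> component_ge n f.
Proof.
move=> /component_ge_pad[N H]; have [c [Gc ->]] := H _ (leq_maxl N n.+1).
exists (maxn N n.+1), (fun k => if k == n then 0 else c k); split=> [k|].
  by case: eqP => // _; apply: component0.
rewrite [RHS]big_ltn ?leq_maxr // eqxx add0r.
by apply: eq_big_nat => k /andP[nk _]; rewrite gtn_eqF.
Qed.

Lemma component_ge_leq n k f : (n <= k)%N -> component_ge k f -> component_ge n f.
Proof.
move=> /subnK <-; elim: (k - n)%N => // i IH.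
by rewrite addSn => /component_geS.
Qed.

Lemma component_ge_split n f : component_ge n f ->
  exists f0 f1, [/\ G n f0, component_ge n.+1 f1 & f = f0 + f1].
Proof.
move=> /component_ge_pad[N H]; have [c [Gc ->]] := H _ (leq_maxl N n.+1).
exists (c n), (\sum_(n.+1 <= k < maxn N n.+1) c k); split=> //.
  by exists (maxn N n.+1), c.
by rewrite big_ltn // leq_maxr.
Qed.

Lemma component_ge_homog0 n f : G n f -> component_ge n.+1 f -> f = 0.
Proof.
move=> Gf /component_ge_pad[N H]; have [c [Gc ef]] := H _ (leq_maxl N n.+1).
pose c' k := if (k < n)%N then 0 else if k == n then - f else c k.
have Gc' k : G k (c' k).
  rewrite /c'; case: ifP => _; first exact: component0.
  by case: eqP => [->|_] //; apply: componentN.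
have := component_direct (N := maxn N n.+1) Gc' _ (leq_maxr _ _ : n < _)%N.
rewrite /c' ltnn eqxx => H'; apply: oppr_inj; rewrite oppr0; apply: H'.
have nN : (n <= maxn N n.+1)%N by rewrite leq_max leqnSn orbT.
rewrite -(big_mkord xpredT c') (big_cat_nat (leq0n n) nN) /=.
rewrite big_nat_cond big1 ?add0r; last first.
  by move=> i /andP[/andP[_ lin] _]; rewrite /c' lin.
rewrite big_ltn ?leq_maxr // /c' ltnn eqxx {1}ef.
rewrite [X in _ + X](_ : _ = \sum_(n.+1 <= k < maxn N n.+1) c k) ?addNr //.
by apply: eq_big_nat => k /andP[nk _]; rewrite ltnNge ltnW //= gtn_eqF.
Qed.

Lemma component_ge_full f : component_ge 0 f.
Proof.
have [N [c [Gc ->]]] := component_span G f.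
by exists N, c; rewrite big_mkord.
Qed.

Section AutLinear.
Variable phi : poissonAut B.
Lemma pautD f g : phi (f + g) = phi f + phi g.
Proof. by have := paut_linear phi 1 f g; rewrite !scale1r. Qed.
Lemma pautZ a f : phi (a *: f) = a *: phi f.
Proof.
have p0 : phi 0 = 0 by apply: (addrI (phi 0)); rewrite -pautD !addr0.
by have := paut_linear phi a f 0; rewrite p0 !addr0.
Qed.
Lemma paut0 : phi 0 = 0.
Proof. by rewrite -[X in phi X](scale0r 0) pautZ scale0r. Qed.
Lemma pautN f : phi (- f) = - phi f.
Proof. by rewrite -scaleN1r pautZ scaleN1r. Qed.
Lemma pautB f g : phi (f - g) = phi f - phi g.
Proof. by rewrite pautD pautN. Qed.

Lemma unipotent_ge n f :
  is_unipotent phi -> component_ge n f -> component_ge n (phi f).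
Proof.
move=> up [N [c [Gc ->]]].
elim: N => [|N IH]; first by rewrite big_geq // paut0; apply: component_ge0.
have [Nn|nN] := leqP n N; last by rewrite big_geq // paut0; apply: component_ge0.
rewrite big_nat_recr //= pautD; apply: component_geD => //.
rewrite -[phi (c N)](subrK (c N)); apply: (component_ge_leq Nn).
apply: component_geD; last exact: component_ge_homog.
exact/component_geS/up.
Qed.

Lemma unipotent_ge_inv n f :
  is_unipotent phi -> component_ge n (phi f) -> component_ge n f.
Proof.
move=> up; elim: n => [|n IH] pf; first exact: component_ge_full.
have [f0 [f1 [G0 G1 ef]]] := component_ge_split (IH (component_geS pf)).
suff f00 : f0 = 0 by rewrite ef f00 add0r.
apply: (component_ge_homog0 G0).
have -> : f0 = phi f - phi f1 - (phi f0 - f0).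
  by rewrite ef pautD addrK opprB addrC subrK.
apply: component_geD; last by apply: component_geN; apply: up.
by apply: component_geD => //; apply: component_geN; apply: unipotent_ge.
Qed.
End AutLinear.

Lemma is_unipotent1 : is_unipotent 1%g.
Proof. by move=> n f _; rewrite subrr; apply: component_ge0. Qed.

Lemma is_unipotentM phi psi :
  is_unipotent phi -> is_unipotent psi -> is_unipotent (phi * psi)%g.
Proof.
move=> up us n f Gf.
have -> : (phi * psi)%g f - f = phi (psi f - f) + (phi f - f).
  by rewrite pautB addrA subrK.
by apply: component_geD; [apply: unipotent_ge => //; apply: us | apply: up].
Qed.

Lemma is_unipotentV phi : is_unipotent phi -> is_unipotent (phi^-1)%g.
Proof.
move=> up n f Gf; apply: (unipotent_ge_inv up).
rewrite pautB [phi _](paut_Kinv phi) -opprB.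
exact/component_geN/up.
Qed.

Record unipotentAut := UnipotentAut {
  uaut_val :> poissonAut B;
  uautP : is_unipotent uaut_val
}.

Lemma uaut_inj : injective uaut_val.
Proof.
case=> f uf [g ug] /= fg; case: _ / fg ug => ug.
congr UnipotentAut; exact: Prop_irrelevance.
Qed.

HB.instance Definition _ := gen_eqMixin unipotentAut.
HB.instance Definition _ := gen_choiceMixin unipotentAut.

Definition uaut_one := UnipotentAut is_unipotent1.
Definition uaut_mul (phi psi : unipotentAut) :=
  UnipotentAut (is_unipotentM (uautP phi) (uautP psi)).
Definition uaut_inv (phi : unipotentAut) :=
  UnipotentAut (is_unipotentV (uautP phi)).

Lemma uaut_mulA : associative uaut_mul.
Proof. by move=> *; apply: uaut_inj; apply: mulgA. Qed.
Lemma uaut_mul1 : left_id uaut_one uaut_mul.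
Proof. by move=> *; apply: uaut_inj; apply: mul1g. Qed.
Lemma uaut_1mul : right_id uaut_one uaut_mul.
Proof. by move=> *; apply: uaut_inj; apply: mulg1. Qed.
Lemma uaut_mulV : left_inverse uaut_one uaut_inv uaut_mul.
Proof. by move=> *; apply: uaut_inj; apply: mulVg. Qed.
Lemma uaut_Vmul : right_inverse uaut_one uaut_inv uaut_mul.
Proof. by move=> *; apply: uaut_inj; apply: mulgV. Qed.

HB.instance Definition _ := isGroup.Build unipotentAut
  uaut_mulA uaut_mul1 uaut_1mul uaut_mulV uaut_Vmul.

End Gradings.

Arguments unipotentAut {K A B} G.

(* [ring] and [field] do not terminate on the fraction field below. *)
Section Identities.
Variable L : fieldType.
Implicit Types f g n d p q a b : L.

Fact quotient_rule_id f d q n' d' p' q' : d != 0 ->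
  n' * q + f * d * q' = p' * d + f * q * d' ->
  (n' * d - f * d * d') / d ^+ 2 * q = p' - f * q'.
Proof.
move=> d0 H; have -> : p' = (n' * q + f * d * q' - f * q * d') / d.
  by rewrite H; field.
by field.
Qed.
Fact cross_id f d q : f * d * q = f * q * d.
Proof. by ring. Qed.
Fact fraction_add_id f g d e : (f + g) * (d * e) = f * d * e + g * e * d.
Proof. by ring. Qed.
Fact fraction_mul_id f g d e : f * g * (d * e) = f * d * (g * e).
Proof. by ring. Qed.
Fact derivation_add_id f g d e f' g' d' e' :
  (f' * d + f * d') * e + f * d * e' + ((g' * e + g * e') * d + g * e * d')
    - (f + g) * (d' * e + d * e') = (f' + g') * (d * e).
Proof. by ring. Qed.
Fact derivation_mul_id f g d e f' g' d' e' :
  (f' * d + f * d') * (g * e) + f * d * (g' * e + g * e')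
    - f * g * (d' * e + d * e') = (f' * g + f * g') * (d * e).
Proof. by ring. Qed.
Fact commutator_id f d f1 f2 d1 d2 d12 f12 f21 :
  f12 * d + f1 * d2 + (f2 * d1 + f * d12) =
  f21 * d + f2 * d1 + (f1 * d2 + f * d12) -> f12 * d = f21 * d.
Proof. by move=> H; apply: (addIr (f1 * d2 + (f2 * d1 + f * d12))); rewrite addrA H; ring. Qed.
Fact leibniz_id f g h g' h' : f * (g' * h + g * h') = f * g' * h + g * (f * h').
Proof. by ring. Qed.
Fact leibniz2_id f g h g' h' : f * (g' * h + g * h') = f * g' * h + f * g * h'.
Proof. by ring. Qed.
Fact rev_id f g h : f * g * h = h * g * f.
Proof. by ring. Qed.
Fact swap_id f g h : f * g * h = f * h * g.
Proof. by ring. Qed.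
Fact cyclic_id f g h : f - g + (g - h) + (h - f) = 0.
Proof. by ring. Qed.
End Identities.

(* The field K(T) = K(y_1, ..., y_m); the library gives {fraction _} no
   K-algebra structure. *)
Definition ratfun (K : fieldType) (m : nat) : Type := {fraction {mpoly K[m]}}.

Section RationalFunctions.
Variables (K : fieldType) (m : nat).
Local Notation F := (ratfun K m).
Local Notation "p %:F" := (@FracField.tofrac {mpoly K[m]} p : F) (at level 1).

HB.instance Definition _ := GRing.Field.on F.

Definition ratfun_scale (a : K) (f : F) : F := (a%:MP)%:F * f.

Fact ratfun_scaleA a b f :
  ratfun_scale a (ratfun_scale b f) = ratfun_scale (a * b) f.
Proof. by rewrite /ratfun_scale mulrA mpolyCM tofracM. Qed.
Fact ratfun_scale1 : left_id 1 ratfun_scale.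
Proof. by move=> f; rewrite /ratfun_scale mpolyC1 tofrac1 mul1r. Qed.
Fact ratfun_scaleDr : right_distributive ratfun_scale +%R.
Proof. by move=> a f g; apply: mulrDr. Qed.
Fact ratfun_scaleDl f : {morph ratfun_scale^~ f : a b / a + b}.
Proof. by move=> a b; rewrite /ratfun_scale mpolyCD tofracD mulrDl. Qed.
HB.instance Definition _ := GRing.Zmodule_isLmodule.Build K F
  ratfun_scaleA ratfun_scale1 ratfun_scaleDr ratfun_scaleDl.

Fact ratfun_scaleAl (a : K) (f g : F) : a *: (f * g) = a *: f * g.
Proof. exact: mulrA. Qed.
HB.instance Definition _ := GRing.Lmodule_isLalgebra.Build K F ratfun_scaleAl.
HB.instance Definition _ := GRing.Lalgebra_isComAlgebra.Build K F.

Definition rvar (i : 'I_m) : F := ('X_i)%:F.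

Definition lmonom (a : 'rV[int]_m) : F := \prod_(i < m) rvar i ^ a 0 i.

Definition laurent_span (Q : 'rV[int]_m -> Prop) (f : F) : Prop :=
  exists s : seq (K * 'rV[int]_m),
    (forall t, t \in s -> Q t.2) /\ f = \sum_(t <- s) t.1 *: lmonom t.2.

Definition laurent : F -> Prop := laurent_span (fun=> True).

(* K[T]_{> n}, for the Z-grading of K[T] with deg y_k = d k. *)
Definition laurent_gt (d : 'I_m -> nat) (n : nat) : F -> Prop :=
  laurent_span (fun a => n%:Z < \sum_(k < m) a 0 k * (d k)%:Z).

(* The derivation y_i d/dy_i of K[y_1, ..., y_m] and of K(T). *)
Definition peuler (i : 'I_m) (p : {mpoly K[m]}) : {mpoly K[m]} := 'X_i * p^`M(i).

Definition euler (i : 'I_m) (f : F) : F :=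
  let: (p, q) := (\n_(repr f), \d_(repr f)) in
  ((peuler i p)%:F * q%:F - p%:F * (peuler i q)%:F) / q%:F ^+ 2.

Lemma peulerD i p q : peuler i (p + q) = peuler i p + peuler i q.
Proof. by rewrite /peuler mderivD mulrDr. Qed.

Lemma peulerM i p q : peuler i (p * q) = peuler i p * q + p * peuler i q.
Proof. by rewrite /peuler mderivM mulrDr; congr (_ + _); [exact: mulrA | exact: mulrCA]. Qed.

Lemma peulerX i j : peuler i 'X_j = (i == j)%:R * 'X_j.
Proof.
rewrite /peuler mderivX mnmE; case: (eqVneq j i) => [->|_].
  have -> : (U_(i) - U_(i) = 0)%MM by rewrite -[X in (X - _)%MM]add0m addmK.
  by rewrite scale1r mpolyX0 mulr1 mul1r.
by rewrite scale0r mulr0 mul0r.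
Qed.

Lemma peulerC i a : peuler i a%:MP = 0.
Proof. by rewrite /peuler mderivC mulr0. Qed.

Lemma peuler_comm i j p : peuler i (peuler j p) = peuler j (peuler i p).
Proof.
have E k l : peuler k (peuler l p) =
    (k == l)%:R * ('X_l * p^`M(l)) + 'X_l * ('X_k * p^`M(l)^`M(k)).
  by rewrite {2}/peuler peulerM peulerX mulrA.
rewrite !E mderiv_comm [j == i]eq_sym; case: eqVneq => [->|_] //.
by rewrite !mul0r !add0r mulrCA.
Qed.

Lemma frac_pi (x : {ratio {mpoly K[m]}}) :
  (\pi_({fraction {mpoly K[m]}})%qT x : F) * (\d_x)%:F = (\n_x)%:F.
Proof.
unlock FracField.tofrac; rewrite -[LHS]FracField.pi_mul.
apply/eqmodP; rewrite /= FracField.equivfE /FracField.mulf.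
have dx := denom_ratioP x.
by rewrite !numden_Ratio ?mulf_neq0 ?oner_eq0 // !mulr1 mulrC.
Qed.

Lemma frac_repr (f : F) : f * (\d_(repr f))%:F = (\n_(repr f))%:F.
Proof. by have := frac_pi (repr f); rewrite reprK. Qed.

Lemma denom_neq0 (f : F) : (\d_(repr f))%:F != 0 :> F.
Proof. by rewrite [_ == _]tofrac_eq0 denom_ratioP. Qed.

Lemma tofrac_add p q : (p + q)%:F = p%:F + q%:F. Proof. exact: tofracD. Qed.
Lemma tofrac_mul p q : (p * q)%:F = p%:F * q%:F. Proof. exact: tofracM. Qed.
Lemma tofrac_inj p q : p%:F = q%:F -> p = q.
Proof. by move/eqP; rewrite [_ == _]tofrac_eq => /eqP. Qed.

Lemma euler_mul i (f : F) p q : q%:F != 0 -> f * q%:F = p%:F ->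
  euler i f * q%:F = (peuler i p)%:F - f * (peuler i q)%:F.
Proof.
rewrite /euler; move: (frac_repr f) (denom_neq0 f).
move: (\n_(repr f)) (\d_(repr f)) => n d fd d0 q0 fq.
have nq : n * q = p * d.
  by apply: tofrac_inj; rewrite !tofrac_mul -fd -fq; apply: cross_id.
have : (peuler i (n * q))%:F = (peuler i (p * d))%:F by rewrite nq.
rewrite !peulerM.
move: (peuler i p) (peuler i q) (peuler i n) (peuler i d) => p' q' n' d'.
rewrite !tofrac_add !tofrac_mul -fd -fq => H.
exact: (quotient_rule_id d0 H).
Qed.

Lemma euler_poly i p : euler i p%:F = (peuler i p)%:F.
Proof.
have /(_ (oner_neq0 _)) := @euler_mul i p%:F p 1.
rewrite [1%:F]tofrac1 => /(_ (mulr1 _)).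
by rewrite mulr1 -mpolyC1 peulerC [0%:F]tofrac0 mulr0 subr0.
Qed.

Lemma eulerDM i f g : euler i (f + g) = euler i f + euler i g /\
  euler i (f * g) = euler i f * g + f * euler i g.
Proof.
move: (frac_repr f) (denom_neq0 f) (frac_repr g) (denom_neq0 g).
move: (\n_(repr f)) (\d_(repr f)) (\n_(repr g)) (\d_(repr g)).
move=> n d n' d' fn d0 gn d0'.
have Df : (peuler i n)%:F = euler i f * d%:F + f * (peuler i d)%:F.
  by rewrite (euler_mul i d0 fn) subrK.
have Dg : (peuler i n')%:F = euler i g * d'%:F + g * (peuler i d')%:F.
  by rewrite (euler_mul i d0' gn) subrK.
have dd0 : (d * d')%:F != 0 by rewrite tofrac_mul; exact: (mulf_neq0 d0 d0').
split; apply: (mulIf dd0).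
  rewrite (@euler_mul i (f + g) (n * d' + n' * d) (d * d')) //; last first.
    rewrite !(tofrac_add, tofrac_mul) -fn -gn; exact: fraction_add_id.
  rewrite peulerD !peulerM; move: Df Dg.
  move: (peuler i n) (peuler i n') (peuler i d) (peuler i d') => a a' b b' Df Dg.
  rewrite !(tofrac_add, tofrac_mul) Df Dg -fn -gn; exact: derivation_add_id.
rewrite (@euler_mul i (f * g) (n * n') (d * d')) //; last first.
  rewrite !(tofrac_add, tofrac_mul) -fn -gn; exact: fraction_mul_id.
rewrite !peulerM; move: Df Dg.
move: (peuler i n) (peuler i n') (peuler i d) (peuler i d') => a a' b b' Df Dg.
rewrite !(tofrac_add, tofrac_mul) Df Dg -fn -gn; exact: derivation_mul_id.
Qed.

Lemma eulerD i f g : euler i (f + g) = euler i f + euler i g.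
Proof. by case: (eulerDM i f g). Qed.
Lemma eulerM i f g : euler i (f * g) = euler i f * g + f * euler i g.
Proof. by case: (eulerDM i f g). Qed.

Lemma eulerZ i a f : euler i (a *: f) = a *: euler i f.
Proof. by rewrite eulerM euler_poly peulerC [0%:F]tofrac0 mul0r add0r. Qed.

Lemma euler0 i : euler i 0 = 0.
Proof. by rewrite -[X in euler i X](scale0r 0) eulerZ scale0r. Qed.

Lemma euler_sum i I (r : seq I) (P : pred I) (f : I -> F) :
  euler i (\sum_(j <- r | P j) f j) = \sum_(j <- r | P j) euler i (f j).
Proof. by apply: (big_morph (euler i)); [apply: eulerD | apply: euler0]. Qed.

Lemma euler_comm i j f : euler i (euler j f) = euler j (euler i f).
Proof.
move: (frac_repr f) (denom_neq0 f); move: (\n_(repr f)) (\d_(repr f)) => n d.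
move=> fn d0; apply: (mulIf d0).
have: euler i (euler j n%:F) = euler j (euler i n%:F).
  by rewrite !euler_poly peuler_comm.
have: euler i (euler j d%:F) = euler j (euler i d%:F).
  by rewrite !euler_poly peuler_comm.
by rewrite -fn !(eulerD, eulerM) => ->; apply: commutator_id.
Qed.

Record bicharacter := Bicharacter {
  bichar :> 'rV[int]_m -> 'rV[int]_m -> K;
  bicharD : forall a, {morph bichar a : b c / b + c};
  bichar_skew : forall a b, bichar a b = - bichar b a
}.

Variable Omega : bicharacter.

Let lam (i j : 'I_m) : K := Omega (delta_mx 0 i) (delta_mx 0 j).

(* The bracket {.,.}_Omega; lemma toric_bracketE is its defining property. *)
Definition toric_bracket_fun (f g : F) : F :=
  \sum_(i < m) \sum_(j < m)
    Omega (delta_mx 0 i) (delta_mx 0 j) *: (euler i f * euler j g).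

Fact toric_linear f : linear (toric_bracket_fun f).
Proof.
move=> a g h; rewrite /toric_bracket_fun scaler_sumr -big_split /=.
apply: eq_bigr => i _; rewrite scaler_sumr -big_split /=; apply: eq_bigr => j _.
by rewrite eulerD eulerZ mulrDr scalerDr -scalerAr !scalerA [_ * a]mulrC.
Qed.

Fact toric_skew f g : toric_bracket_fun f g = - toric_bracket_fun g f.
Proof.
rewrite /toric_bracket_fun exchange_big /= -sumrN; apply: eq_bigr => i _.
rewrite -sumrN; apply: eq_bigr => j _.
by rewrite bichar_skew scaleNr [euler j f * _]mulrC.
Qed.

Fact toric_leibniz f g h : toric_bracket_fun f (g * h) =
  toric_bracket_fun f g * h + g * toric_bracket_fun f h.
Proof.
rewrite /toric_bracket_fun mulr_suml mulr_sumr -big_split /=.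
apply: eq_bigr => i _; rewrite mulr_suml mulr_sumr -big_split /=.
apply: eq_bigr => j _.
rewrite eulerM -scalerAl -scalerAr -scalerDr; congr (_ *: _).
exact: leibniz_id.
Qed.

Let S f g h : F := \sum_(t : 'I_m * 'I_m * 'I_m * 'I_m)
  (lam t.1.1.1 t.1.1.2 * lam t.1.2 t.2) *:
     (euler t.1.1.1 f * euler t.1.1.2 (euler t.1.2 g) * euler t.2 h).

Let S_sym f g h : S h g f = S f g h.
Proof.
rewrite /S; pose r (t : 'I_m * 'I_m * 'I_m * 'I_m) := (t.2, t.1.2, t.1.1.2, t.1.1.1).
have rK : involutive r by case=> [[[i j] k] l].
rewrite (reindex_inj (inv_inj rK)); apply: eq_bigr => -[[[i j] k] l] _ /=.
rewrite /lam [Omega (delta_mx 0 l) _]bichar_skew [Omega (delta_mx 0 j) _]bichar_skew.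
rewrite mulrNN [X in X *: _]mulrC euler_comm; congr (_ *: _).
exact: rev_id.
Qed.

Let toric_nested f g h :
  toric_bracket_fun f (toric_bracket_fun g h) = S f g h - S f h g.
Proof.
transitivity (S f g h + \sum_(t : 'I_m * 'I_m * 'I_m * 'I_m)
  (lam t.1.1.1 t.1.1.2 * lam t.1.2 t.2) *:
     (euler t.1.1.1 f * euler t.1.2 g * euler t.1.1.2 (euler t.2 h))).
  rewrite /S -big_split /toric_bracket_fun /=.
  rewrite pair_bigA /=.
  under eq_bigr => p _.
    rewrite !euler_sum mulr_sumr scaler_sumr.
    under eq_bigr => k _.
      rewrite euler_sum mulr_sumr scaler_sumr.
      over.
    over.
  rewrite pair_bigA pair_bigA /=; apply: eq_bigr => -[[[i j] k] l] _ /=.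
  rewrite eulerZ eulerM -scalerAr scalerA -scalerDr; congr (_ *: _).
  exact: leibniz2_id.
congr (_ + _); rewrite -sumrN.
pose r (t : 'I_m * 'I_m * 'I_m * 'I_m) := (t.1.1.1, t.1.1.2, t.2, t.1.2).
have rK : involutive r by case=> [[[i j] k] l].
rewrite (reindex_inj (inv_inj rK)); apply: eq_bigr => -[[[i j] k] l] _ /=.
rewrite {2}/lam bichar_skew mulrN scaleNr; congr (- (_ *: _)).
exact: swap_id.
Qed.

Fact toric_jacobi f g h :
  toric_bracket_fun f (toric_bracket_fun g h)
  + toric_bracket_fun g (toric_bracket_fun h f)
  + toric_bracket_fun h (toric_bracket_fun f g) = 0.
Proof.
rewrite !toric_nested [S h g f]S_sym [S g f h]S_sym [S f h g]S_sym.
exact: cyclic_id.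
Qed.

Definition toric_bracket : poissonBracket F :=
  PoissonBracket toric_linear toric_skew toric_jacobi toric_leibniz.

Lemma euler_exprz i (f : F) (c : K) (z : int) :
  f != 0 -> euler i f = c *: f -> euler i (f ^ z) = (c *~ z) *: f ^ z.
Proof.
move=> f0 Df.
have eul1 : euler i 1 = 0.
  by have := euler_poly i 1; rewrite [1%:F]tofrac1 -mpolyC1 peulerC [0%:F]tofrac0.
have pos n : euler i (f ^+ n) = (c *+ n) *: f ^+ n.
  elim: n => [|n IH]; first by rewrite expr0 mulr0n scale0r.
  by rewrite exprS eulerM IH Df -scalerAl -scalerAr -scalerDl mulrS.
case: z => n; first exact: pos.
change (euler i (f ^+ n.+1)^-1 = - (c *+ n.+1) *: (f ^+ n.+1)^-1).
have := pos n.+1; have := expf_neq0 n.+1 f0.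
move: (f ^+ n.+1) => g g0 Dg.
apply: (mulfI g0); apply: (addrI (euler i g * g^-1)); rewrite -eulerM mulfV //.
by rewrite eul1 Dg scaleNr -scalerAl mulrN -scalerAr subrr.
Qed.

Lemma rvar_neq0 i : rvar i != 0.
Proof.
rewrite [_ == _]tofrac_eq0; apply/eqP => X0.
by have := mcoeffX K U_(i)%MM U_(i)%MM; rewrite X0 mcoeff0 eqxx => /eqP;
  rewrite eq_sym oner_eq0.
Qed.

Lemma euler_lmonom i a : euler i (lmonom a) = (a 0 i)%:~R *: lmonom a.
Proof.
rewrite /lmonom.
suff H (r : seq 'I_m) : euler i (\prod_(j <- r) rvar j ^ a 0 j) =
    (\sum_(j <- r) (i == j)%:R *~ a 0 j) *: \prod_(j <- r) rvar j ^ a 0 j.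
  rewrite H (bigD1 i) //= eqxx big1 ?addr0 // => j /negPf ji.
  by rewrite eq_sym ji mul0rz.
elim: r => [|j r IH].
  have := euler_poly i 1; rewrite [1%:F]tofrac1 -mpolyC1 peulerC [0%:F]tofrac0.
  by rewrite !big_nil scale0r.
rewrite !big_cons eulerM IH (euler_exprz (c := (i == j)%:R)) ?rvar_neq0 //.
  by rewrite -scalerAl -scalerAr -scalerDl.
rewrite euler_poly peulerX tofrac_mul -mpolyC_nat //.
Qed.

Lemma bichar_coord (a b : 'rV[int]_m) :
  Omega a b = \sum_i \sum_j lam i j *~ a 0 i *~ b 0 j.
Proof.
have coord (f : 'rV[int]_m -> K) (c : 'rV[int]_m) : {morph f : x y / x + y} ->
    f c = \sum_j f (delta_mx 0 j) *~ c 0 j.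
  move=> fD; have f0 : f 0 = 0 by apply: (addrI (f 0)); rewrite -fD !addr0.
  have fN x : f (- x) = - f x.
    by apply: (addrI (f x)); rewrite -fD !subrr f0.
  have fn x n : f (x *+ n) = f x *+ n.
    by elim: n => [|n IH]; rewrite ?mulr0n // !mulrS fD IH.
  have fz x z : f (x *~ z) = f x *~ z.
    by case: z => n; rewrite ?NegzE ?mulrNz ?fN; [apply: fn | congr (- _); apply: fn].
  rewrite {1}[c]row_sum_delta (big_morph f fD f0); apply: eq_bigr => j _.
  by rewrite -fz -scaler_int intz.
have OD y : {morph Omega^~ y : x x' / x + x'}.
  move=> x x'; rewrite /= !(bichar_skew Omega _ y) bicharD opprD //.
rewrite (coord _ a (OD b)); apply: eq_bigr => i _.
rewrite (coord _ b (bicharD Omega _)) mulrz_suml.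
by apply: eq_bigr => j _ /=; rewrite -!mulrzA mulrC.
Qed.

Lemma toric_bracketE a b : toric_bracket (lmonom a) (lmonom b) =
  Omega a b *: (lmonom a * lmonom b).
Proof.
rewrite bichar_coord scaler_suml; apply: eq_bigr => i _.
rewrite scaler_suml; apply: eq_bigr => j _.
rewrite !euler_lmonom -scalerAl -scalerAr !scalerA; congr (_ *: _).
by rewrite !mulrzr.
Qed.

End RationalFunctions.

Arguments toric_bracket {K m} Omega.

Section BiIntegral.
Variables (K : fieldType) (m : nat) (B : poissonBracket (ratfun K m)).

Definition bi_integral (phi : poissonAut B) : Prop :=
  forall k, laurent (phi (rvar K k)) /\ laurent ((phi^-1)%g (rvar K k)).

(* d k is the degree of y_k. *)
Definition unipotent_bi_integral (d : 'I_m -> nat) (phi : poissonAut B) : Prop :=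
  bi_integral phi /\
  forall k, laurent_gt d (d k) (phi (rvar K k) - rvar K k).

End BiIntegral.

(* (y_1, ..., y_m) is a Poisson cluster of A with {y_j, y_k} = lam j k y_j y_k.
   The inclusion of A in K[y_1^{+-1}, ..., y_m^{+-1}] over K[y_1, ..., y_m] is
   an embedding j of A in K(T), which is uniquely determined by y. *)
Record poisson_cluster (K : fieldType) (A : comAlgType K) (B : poissonBracket A)
    (m : nat) (y : 'I_m -> A) (lam : 'I_m -> 'I_m -> K)
    (j : {lrmorphism A -> ratfun K m}) : Prop := PoissonCluster {
  cluster_bracket : forall k l, B (y k) (y l) = lam k l *: (y k * y l);
  cluster_indep : injective (mmap (in_alg A) y);
  cluster_incl_inj : injective j;
  cluster_incl_var : forall k, j (y k) = rvar K k;
  cluster_incl_laurent : forall f, laurent (j f)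
}.

(* Main.v *)
From HB Require Import structures.
Require Import Defs.
From mathcomp Require Import all_boot all_order all_algebra.
From mathcomp Require Import mpoly.

Set Implicit Arguments.
Unset Strict Implicit.
Unset Printing Implicit Defensive.

Import Order.TTheory GRing.Theory Num.Theory.
Local Open Scope ring_scope.

(** The Laurent phenomenon makes every element of P a quotient of two elements
    of the polynomial ring K[y], which is a subring both of P and of K(T).  So P
    lies between K[y] and its fraction field K(T), and whatever is compatible
    with sums, products and division is determined by its values at the y_k;
    this principle is [rationally_generated_ind], and it is used for each of the
    following points.

    - A Poisson automorphism phi of P sends K[y] injectively into K(T), hence
      extends to the fraction field K(T) of K[y].  The extension agrees with phi
      on all of P, because it does so on the y_k ([extend_lrmorphism]).
    - It is the only extension, since a K-linear field morphism on K(T) is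
      determined by its values at the y_k.  Uniqueness yields multiplicativity:
      the extension of a composite, or of an inverse, is the composite or the
      inverse of the extensions.
    - The bracket of P is the restriction of the toric one, and the extension of
      phi preserves the toric bracket: in both cases two biderivations are
      compared, and these agree once they agree on the pairs (y_k, y_l)
      ([bracket_morph]).

    Injectivity of phi |-> iota(phi) and bi-integrality are then immediate, the
    latter because iota(phi)(y_k) = phi(y_k) lies in P, hence in K[T], and the
    same holds for the inverse of phi.

    Unipotence needs in addition that the inclusion of P in K[T] respects the
    gradings ([incl_homog]).  If f in P has degree n, multiply its Laurent
    expansion by a monomial u that clears all denominators.  This gives an
    equality in P between f u, of degree n + deg u, and a linear combination of
    monomials in the y_k.  As the components of P are in direct sum, only the
    monomials of degree n + deg u contribute, and dividing by u writes f as a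
    combination of Laurent monomials of degree n. *)

Local Notation eval y := (mmap (GRing.in_alg _) y).
Local Notation "p %:F" := (@FracField.tofrac {mpoly _[_]} p : ratfun _ _)
  (at level 1).

(** * Algebras of fractions of polynomials in given elements *)

Lemma mpoly_alg_ind (K : fieldType) (m : nat) (Q : {mpoly K[m]} -> Prop) :
    (forall a, Q a%:MP) -> (forall k, Q 'X_k) ->
    (forall p q, Q p -> Q q -> Q (p + q)) ->
    (forall p q, Q p -> Q q -> Q (p * q)) ->
  forall p, Q p.
Proof.
move=> QC QX QD QM; have Q1 : Q 1 by rewrite -mpolyC1; apply: QC.
elim/mpolyind => [|a u p _ _ Qp]; first by rewrite -(mpolyC0 m K); apply: QC.
apply: (QD) => //; rewrite -mul_mpolyC; apply: (QM) => //.
rewrite mpolyXE_id; elim/big_ind: _ => // k _.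
by elim: (u k) => [|n IH]; rewrite ?expr0 // exprS; apply: QM.
Qed.

(** The algebra A consists of fractions of polynomials in y; for A a domain in
    which the y_k are algebraically independent, it lies in the field K(y). *)
Definition rationally_generated (K : fieldType) (A : comAlgType K) (m : nat)
    (y : 'I_m -> A) : Prop :=
  forall f, exists u p, eval y u != 0 /\ f * eval y u = eval y p.

(** The closure under division, stated as cancellation of a nonzero g with
    Q g and Q (f * g), applies also when A contains no quotients. *)
Lemma rationally_generated_ind (K : fieldType) (A : comAlgType K) (m : nat)
    (y : 'I_m -> A) (Q : A -> Prop) :
    rationally_generated y ->
    (forall a, Q a%:A) -> (forall k, Q (y k)) ->
    (forall f g, Q f -> Q g -> Q (f + g)) ->
    (forall f g, Q f -> Q g -> Q (f * g)) ->
    (forall f g, g != 0 -> Q g -> Q (f * g) -> Q f) ->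
  forall f, Q f.
Proof.
move=> genA QC Qy QD QM Qdiv f.
have Qeval p : Q (eval y p).
  elim/mpoly_alg_ind: p => [a|k|p q Qp Qq|p q Qp Qq].
  - by rewrite mmapC; apply: QC.
  - by rewrite mmapX mmap1U.
  - by rewrite rmorphD; apply: QD.
  - by rewrite rmorphM; apply: QM.
by have [u [p [u0 fu]]] := genA f; apply: (Qdiv _ _ u0) => //; rewrite fu.
Qed.

Section RationalFunctions.
Variables (K : fieldType) (m : nat).
Local Notation F := (ratfun K m).

Lemma ratfun_scalarE (a : K) : a%:A = (a%:MP)%:F :> F.
Proof. exact: mulr1. Qed.

Lemma eval_rvar p : eval (@rvar K m) p = p%:F :> F.
Proof.
elim/mpoly_alg_ind: p => [a|k|p q Qp Qq|p q Qp Qq].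
- by rewrite mmapC -ratfun_scalarE.
- by rewrite mmapX mmap1U.
- by rewrite tofrac_add -Qp -Qq; apply: rmorphD.
- by rewrite tofrac_mul -Qp -Qq; apply: rmorphM.
Qed.

Lemma rvar_generated : rationally_generated (@rvar K m).
Proof.
move=> f; exists (\d_(repr f)), (\n_(repr f)).
by rewrite !eval_rvar denom_neq0 frac_repr.
Qed.

Lemma ratfun_lrmorph_ext (f1 f2 : {lrmorphism F -> F}) :
  (forall k, f1 (rvar K k) = f2 (rvar K k)) -> f1 =1 f2.
Proof.
move=> eqv; apply: (rationally_generated_ind rvar_generated) => //.
- by move=> a; rewrite !rmorph_alg.
- by move=> f g Qf Qg; rewrite !rmorphD /= Qf Qg.
- by move=> f g Qf Qg; rewrite !rmorphM /= Qf Qg.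
- move=> f g g0 Qg; rewrite !rmorphM /= Qg; apply: mulIf.
  by rewrite -(rmorph0 f2) (inj_eq (fmorph_inj f2)).
Qed.

Lemma rvar_lmonom (k : 'I_m) : rvar K k = lmonom K (delta_mx 0 k).
Proof.
rewrite /lmonom (bigD1 k) //= mxE !eqxx big1 ?mulr1 // => i /negPf ik.
by rewrite mxE ik.
Qed.

Lemma lmonomD (a b : 'rV[int]_m) : lmonom K (a + b) = lmonom K a * lmonom K b.
Proof.
rewrite /lmonom -big_split; apply: eq_bigr => i _ /=.
by rewrite mxE expfzDr // rvar_neq0.
Qed.

Lemma lmonom_mnm (u : 'X_{1..m}) : lmonom K (\row_i (u i)%:Z) = 'X_[u]%:F.
Proof.
rewrite mpolyXE_id rmorph_prod; apply: eq_bigr => i _.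
by rewrite mxE rmorphXn.
Qed.

End RationalFunctions.

Section Extension.
Variables (K : fieldType) (m : nat) (h : {rmorphism {mpoly K[m]} -> ratfun K m}).
Hypothesis h_inj : injective h.
Local Notation F := (ratfun K m).

Definition frac_ext (f : F) : F := h \n_(repr f) / h \d_(repr f).

Let h_neq0 (p : {mpoly K[m]}) : p != 0 -> h p != 0.
Proof. by move=> p0; rewrite -(rmorph0 h) (inj_eq h_inj). Qed.

(** Independence of the fraction that represents f; the morphism laws below
    follow by choosing convenient denominators. *)
Lemma frac_extE f p q : q != 0 -> f * q%:F = p%:F -> frac_ext f * h q = h p.
Proof.
move=> q0 fq; rewrite /frac_ext; move: (frac_repr f) (denom_neq0 f).
move: (\n_(repr f)) (\d_(repr f)) => n d fd; rewrite [_ == _]tofrac_eq0 => d0.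
have : n * q = p * d.
  by apply: tofrac_inj; rewrite !tofrac_mul -fd -fq mulrAC.
move/(congr1 h); rewrite !rmorphM => e.
by rewrite mulrAC e mulfK ?h_neq0.
Qed.

Lemma frac_ext_poly p : frac_ext p%:F = h p.
Proof.
have := @frac_extE p%:F p 1 (oner_neq0 _).
by rewrite [1%:F]tofrac1 rmorph1 !mulr1; apply.
Qed.

Let frac_pres (f : F) : exists p q, q != 0 /\ f * q%:F = p%:F.
Proof.
exists \n_(repr f), \d_(repr f); split; last exact: frac_repr.
by have := denom_neq0 f; rewrite [_ == _]tofrac_eq0.
Qed.

Lemma frac_extD : {morph frac_ext : f g / f + g}.
Proof.
move=> f g; have [p [q [q0 fq]]] := frac_pres f.
have [p' [q' [q0' fq']]] := frac_pres g.
apply: (mulIf (h_neq0 (mulf_neq0 q0 q0'))).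
rewrite (@frac_extE _ (p * q' + p' * q)) ?mulf_neq0 //.
  rewrite rmorphD !rmorphM -(frac_extE q0 fq) -(frac_extE q0' fq').
  exact/esym/fraction_add_id.
by rewrite tofrac_add !tofrac_mul -fq -fq'; apply: fraction_add_id.
Qed.

Lemma frac_extM : {morph frac_ext : f g / f * g}.
Proof.
move=> f g; have [p [q [q0 fq]]] := frac_pres f.
have [p' [q' [q0' fq']]] := frac_pres g.
apply: (mulIf (h_neq0 (mulf_neq0 q0 q0'))).
rewrite (@frac_extE _ (p * p')) ?mulf_neq0 //.
  rewrite !rmorphM -(frac_extE q0 fq) -(frac_extE q0' fq').
  exact/esym/fraction_mul_id.
by rewrite !tofrac_mul -fq -fq'; apply: fraction_mul_id.
Qed.

End Extension.

(** * Poisson brackets on algebras of fractions *)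

Section Brackets.
Variables (K : fieldType) (A : comAlgType K) (B : poissonBracket A).

HB.instance Definition _ f :=
  GRing.isLinear.Build K A A *:%R (pbracket B f) (pbracket_linear B f).

HB.instance Definition _ (phi : poissonAut B) :=
  GRing.isLinear.Build K A A *:%R (paut_fun phi) (paut_linear phi).
HB.instance Definition _ (phi : poissonAut B) :=
  GRing.isMonoidMorphism.Build A A (paut_fun phi) (paut_monoid_morphism phi).

Lemma pbracketD f : {morph B f : g h / g + h}.
Proof. by move=> g h; apply: raddfD. Qed.

Lemma pbracket_scalar f a : B f a%:A = 0.
Proof.
rewrite linearZ /=; suff -> : B f 1 = 0 by rewrite scaler0.
have := pbracket_leibniz B f 1 1; rewrite !mulr1 mul1r => /eqP.
by rewrite -subr_eq subrr => /eqP.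
Qed.

End Brackets.

Section BracketMorphism.
Variables (K : fieldType) (A : comAlgType K) (B : poissonBracket A) (m : nat).
Variables (y : 'I_m -> A) (genA : rationally_generated y).
Local Notation F := (ratfun K m).
Variables (C : poissonBracket F) (s : {lrmorphism A -> F}).
Hypothesis s_inj : injective s.

(** Both sides are derivations in g along s, so division is covered by the
    Leibniz rule: the terms in which h is differentiated cancel. *)
Let bracket_morph1 f : (forall l, s (B f (y l)) = C (s f) (s (y l))) ->
  forall g, s (B f g) = C (s f) (s g).
Proof.
move=> fy; apply: (rationally_generated_ind genA) => //
  [a|g h Qg Qh|g h Qg Qh|g h h0 Qh].
- by rewrite rmorph_alg !pbracket_scalar rmorph0.
- by rewrite rmorphD !pbracketD rmorphD /= Qg Qh.
- by rewrite rmorphM !pbracket_leibniz rmorphD !rmorphM /= Qg Qh.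
- rewrite rmorphM !pbracket_leibniz rmorphD !rmorphM /= Qh => /addIr.
  by apply: mulIf; rewrite -(rmorph0 s) (inj_eq s_inj).
Qed.

(** Two passes of the one-variable argument, exchanged by skewsymmetry: the
    first replaces y_l by any element, the second y_k. *)
Lemma bracket_morph :
    (forall k l, s (B (y k) (y l)) = C (s (y k)) (s (y l))) ->
  {morph s : f g / B f g >-> C f g}.
Proof.
move=> yy f; apply: bracket_morph1 => l.
by rewrite pbracket_skew [RHS]pbracket_skew rmorphN /= (bracket_morph1 (yy l)).
Qed.

End BracketMorphism.

(** * Homogeneous elements *)

Section Homogeneous.
Variables (K : fieldType) (A : comAlgType K) (B : poissonBracket A).
Variables (G : poissonGrading B).

Lemma component_sum (I : Type) (r : seq I) (Q : pred I) (f : I -> A) n :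
  (forall i, Q i -> G n (f i)) -> G n (\sum_(i <- r | Q i) f i).
Proof.
move=> Gf; elim/big_ind: _ => //; first exact: component0.
by move=> ? ?; apply: componentD.
Qed.

Lemma componentZ n a f : G n f -> G n (a *: f).
Proof.
move=> Gf; rewrite -[_ *: _]addr0.
by apply: component_linear => //; apply: component0.
Qed.

(** Directness of the grading, in the form used to read off a component: in any
    expression of g by homogeneous terms, those of other degrees add up to 0. *)
Lemma homogeneous_part (I : eqType) (s : seq I) (deg : I -> nat) (f : I -> A)
    n g :
    G n g -> g = \sum_(i <- s) f i -> (forall i, G (deg i) (f i)) ->
  g = \sum_(i <- s | deg i == n) f i.
Proof.
move=> Gg eg Gf; pose N := (n + \sum_(i <- s) deg i).+1.
pose c k := \sum_(i <- s | deg i == k) f i - (if k == n then g else 0).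
(* c k is the degree k part of the difference of the two sides of eg. *)
have Gc k : G k (c k).
  apply: componentD; last apply: componentN.
    by apply: component_sum => i /eqP <-.
  by case: eqP => [->|_] //; apply: component0.
have ltnN : (n < N)%N by rewrite ltnS leq_addr.
suff /(component_direct Gc)/(_ _ ltnN)/eqP : \sum_(k < N) c k = 0.
  by rewrite /c eqxx subr_eq0 => /eqP.
rewrite sumrB -(big_mkord xpredT (fun k => if k == n then g else 0)) big_mkord.
rewrite -(big_mkcond (fun k : 'I_N => k == n :> nat)) /=.
rewrite (big_ord1_eq _ (fun=> g)) ltnN.
rewrite (eq_bigr _ (fun k _ => big_mkcond _ _)) exchange_big /= [in X in _ - X]eg.
apply/eqP; rewrite subr_eq0; apply/eqP; apply: eq_big_seq => i si.
rewrite -big_mkcond; under eq_bigl do rewrite eq_sym.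
rewrite (big_ord1_eq _ (fun=> f i)) ltnS.
by rewrite (big_rem i) //= addnCA leq_addr.
Qed.

Variables (m : nat) (y : 'I_m -> A) (d : 'I_m -> nat).
Hypothesis y_homog : forall k, G (d k) (y k).

Lemma mmap1_homog (u : 'X_{1..m}) :
  G (\sum_(k < m) u k * d k)%N (mmap1 y u).
Proof.
rewrite /mmap1; elim/big_ind2: _ => [|????|k _].
- exact: component1.
- by move=> Gf Gg; apply: componentM.
- elim: (u k) => [|n IH]; first by rewrite expr0; apply: component1.
  by rewrite exprS mulSn; apply: componentM.
Qed.

End Homogeneous.

Section LaurentSpan.
Variables (K : fieldType) (m : nat).
Local Notation F := (ratfun K m).

Lemma laurent_span0 Q : laurent_span Q (0 : F).
Proof. by exists [::]; rewrite big_nil; split. Qed.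

Lemma laurent_spanD Q (f g : F) :
  laurent_span Q f -> laurent_span Q g -> laurent_span Q (f + g).
Proof.
move=> [s [Qs ->]] [t [Qt ->]]; exists (s ++ t); rewrite big_cat; split=> // r.
by rewrite mem_cat => /orP[/Qs|/Qt].
Qed.

Lemma laurent_spanW (Q Q' : 'rV[int]_m -> Prop) (f : F) :
  (forall a, Q a -> Q' a) -> laurent_span Q f -> laurent_span Q' f.
Proof. by move=> QQ' [s [Qs ->]]; exists s; split=> // t /Qs/QQ'. Qed.

(** The exponent a + u; it is the intended one only when a + u has no negative
    entry, the absolute value being a junk value otherwise. *)
Definition shift_mnm (u : 'X_{1..m}) (a : 'rV[int]_m) : 'X_{1..m} :=
  [multinom `|(a 0 i + (u i)%:Z)%R|%N | i < m].

Lemma clear_denominators (s : seq (K * 'rV[int]_m)) :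
  exists u : 'X_{1..m}, forall t, t \in s ->
    forall i, (shift_mnm u t.2 i)%:Z = t.2 0 i + (u i)%:Z.
Proof.
(* The sum of the absolute values is an easy upper bound of the -t.2 0 i. *)
exists [multinom (\sum_(t <- s) `|t.2 0%R i|)%N | i < m] => t st i.
rewrite !mnmE gez0_abs // (big_rem t) //=.
move: (_ 0 i) (\sum_(_ <- _) _)%N => z n; rewrite PoszD addrA.
by rewrite addr_ge0 // abszE -lerBlDr sub0r lerNnormlW.
Qed.

Lemma lmonom_shift u (a : 'rV[int]_m) :
    (forall i, (shift_mnm u a i)%:Z = a 0 i + (u i)%:Z) ->
  lmonom K a * 'X_[u]%:F = 'X_[shift_mnm u a]%:F.
Proof.
move=> ua; rewrite -!lmonom_mnm -lmonomD; congr lmonom.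
by apply/rowP => i; rewrite !mxE ua.
Qed.

End LaurentSpan.

(** * The cluster embedding *)

Section Cluster.
Variables (K : fieldType) (P : comAlgType K) (B : poissonBracket P).
Variables (G : poissonGrading B) (m : nat) (y : 'I_m -> P).
Variables (lam : 'I_m -> 'I_m -> K) (incl : {lrmorphism P -> ratfun K m}).
Hypothesis y_cluster : poisson_cluster B y lam incl.
Local Notation F := (ratfun K m).

Let incl_inj : injective incl := cluster_incl_inj y_cluster.

Lemma incl_eval p : incl (eval y p) = p%:F.
Proof.
elim/mpoly_alg_ind: p => [a|k|p q Qp Qq|p q Qp Qq].
- by rewrite mmapC rmorph_alg ratfun_scalarE.
- by rewrite mmapX mmap1U (cluster_incl_var y_cluster).
- rewrite tofrac_add -Qp -Qq -rmorphD; congr (incl _); exact: rmorphD.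
- rewrite tofrac_mul -Qp -Qq -rmorphM; congr (incl _); exact: rmorphM.
Qed.

(** Once the denominators are cleared, the Laurent expansion of f is an identity
    between elements of the image of P, so it pulls back to P, where the grading
    lives. *)
Lemma incl_denominators f : exists (s : seq (K * 'rV[int]_m)) (u : 'X_{1..m}),
  [/\ incl f = \sum_(t <- s) t.1 *: lmonom K t.2,
      forall t, t \in s -> lmonom K t.2 * 'X_[u]%:F = 'X_[shift_mnm u t.2]%:F,
      forall t, t \in s -> forall i, (shift_mnm u t.2 i)%:Z = t.2 0 i + (u i)%:Z
    & f * eval y 'X_[u] = \sum_(t <- s) t.1 *: mmap1 y (shift_mnm u t.2)].
Proof.
have [s [_ fs]] := cluster_incl_laurent y_cluster f.
have [u us] := clear_denominators s; exists s, u.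
have us' t : t \in s -> lmonom K t.2 * 'X_[u]%:F = 'X_[shift_mnm u t.2]%:F.
  by move=> /us; apply: lmonom_shift.
split=> //; apply: incl_inj; rewrite rmorphM /= incl_eval fs.
rewrite mulr_suml raddf_sum.
apply: eq_big_seq => t st /=.
by rewrite linearZ /= -(mmapX y (GRing.in_alg P)) incl_eval -scalerAl us'.
Qed.

Lemma cluster_generated : rationally_generated y.
Proof.
move=> f; have [s [u [_ _ _ fu]]] := incl_denominators f.
exists 'X_[u], (\sum_(t <- s) t.1 *: 'X_[shift_mnm u t.2]); split.
  rewrite -(inj_eq incl_inj) incl_eval rmorph0 [_ == _]tofrac_eq0.
  by rewrite -msupp_eq0 msuppX.
rewrite fu raddf_sum; apply: eq_bigr => t _ /=.
by rewrite mmapZ mmapX mulr_algl.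
Qed.

(** The bracket of P is the one that K(T) induces: by [bracket_morph] it is
    enough that both are log-canonical on the cluster, with the same
    coefficients. *)
Lemma incl_bracket (Omega : bicharacter K m) :
    (forall j k, Omega (delta_mx 0 j) (delta_mx 0 k) = lam j k) ->
  {morph incl : f g / B f g >-> toric_bracket Omega f g}.
Proof.
move=> OmegaE; apply: (bracket_morph cluster_generated incl_inj) => k l.
rewrite (cluster_bracket y_cluster) linearZ rmorphM /=.
rewrite !(cluster_incl_var y_cluster) !rvar_lmonom -OmegaE.
exact/esym/toric_bracketE.
Qed.

Variable d : 'I_m -> nat.
Hypothesis y_homog : forall k, G (d k) (y k).

(** The terms of the Laurent expansion of f that are not of degree n add up to
    0: after multiplication by a common denominator they lie in components of P
    other than the one of the product of f and this denominator. *)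
Lemma incl_homog n f : G n f ->
  laurent_span (fun a => \sum_(k < m) a 0 k * (d k)%:Z = n%:Z) (incl f).
Proof.
move=> Gf; have [s [u [fs us degs fu]]] := incl_denominators f.
pose deg (v : 'X_{1..m}) := (\sum_(k < m) v k * d k)%N.
have degE v : deg v = \sum_(k < m) (v k)%:Z * (d k)%:Z :> int.
  rewrite (big_morph Posz PoszD (erefl _)).
  by apply: eq_bigr => k _; apply: PoszM.
exists [seq t <- s | deg (shift_mnm u t.2) == n + deg u]%N; split=> [t|].
  rewrite mem_filter => /andP[/eqP dt /degs st]; apply: (addIr (deg u)%:Z).
  rewrite -PoszD -dt !degE -big_split; apply: eq_bigr => k _ /=.
  by rewrite -mulrDl st.
have Xu0 : 'X_[u]%:F != 0 :> F.
  by rewrite [_ == _]tofrac_eq0 -msupp_eq0 msuppX.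
apply: (mulIf Xu0); rewrite -(incl_eval 'X_[u]) -rmorphM.
have Gfu : G (n + deg u)%N (f * eval y 'X_[u]).
  by apply: componentM => //; rewrite mmapX; apply: mmap1_homog.
have Gt t : G (deg (shift_mnm u t.2)) (t.1 *: mmap1 y (shift_mnm u t.2)).
  by apply: componentZ; apply: mmap1_homog.
rewrite [in LHS](homogeneous_part Gfu fu Gt) big_filter raddf_sum mulr_suml.
rewrite big_seq_cond [RHS]big_seq_cond; apply: eq_bigr => t /andP[st _] /=.
by rewrite linearZ /= -(mmapX y (GRing.in_alg P)) !incl_eval -scalerAl us.
Qed.

Lemma incl_gt n f : component_ge G n.+1 f -> laurent_gt d n (incl f).
Proof.
move=> [N [c [Gc ->]]]; rewrite raddf_sum big_nat_cond.
elim/big_ind: _ => [|g h|k /andP[/andP[nk _] _]]; first exact: laurent_span0.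
  exact: laurent_spanD.
by apply: laurent_spanW (incl_homog (Gc k)) => a ->.
Qed.

(** * Extension of Poisson automorphisms *)

(** The restriction of theta to K[y] is injective, hence extends to fractions;
    the values on the rest of P are forced. *)
Lemma extend_lrmorphism (theta : {lrmorphism P -> F}) : injective theta ->
  exists ext : {lrmorphism F -> F}, forall f, ext (incl f) = theta f.
Proof.
move=> theta_inj; pose h : {rmorphism {mpoly K[m]} -> F} := theta \o eval y.
have h_inj : injective h.
  by move=> p q /theta_inj/(congr1 incl); rewrite !incl_eval => /tofrac_inj.
have ext_monoid : monoid_morphism (frac_ext h).
  split; last exact: frac_extM h_inj.
  by rewrite -[1]tofrac1 [LHS](frac_ext_poly h_inj) rmorph1.
have ext_linear : linear (frac_ext h).
  move=> a f g; rewrite [LHS](frac_extD h_inj); congr (_ + _).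
  rewrite -mulr_algl ratfun_scalarE ext_monoid.2 (frac_ext_poly h_inj) /= mmapC.
  by rewrite rmorph_alg mulr_algl.
pose ext : {lrmorphism F -> F} := HB.pack (frac_ext h)
  (GRing.isLinear.Build K F F *:%R _ ext_linear)
  (GRing.isMonoidMorphism.Build F F _ ext_monoid).
have extE p : ext p%:F = theta (eval y p) by apply: (frac_ext_poly h_inj).
exists ext; apply: (rationally_generated_ind cluster_generated).
- by move=> a; rewrite !rmorph_alg.
- by move=> k; rewrite (cluster_incl_var y_cluster) extE mmapX mmap1U.
- by move=> f g Qf Qg; rewrite !rmorphD; congr (_ + _).
- by move=> f g Qf Qg; rewrite !rmorphM; congr (_ * _).
- move=> f g g0 Qg Qfg; have tg0 : theta g != 0.
    by rewrite -(rmorph0 theta) (inj_eq theta_inj).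
  apply: (mulIf tg0); apply: etrans (etrans Qfg (rmorphM _ _ _)).
  by rewrite !rmorphM; congr (_ * _).
Qed.

Variable Omega : bicharacter K m.
Hypothesis OmegaE :
  forall j k, Omega (delta_mx 0 j) (delta_mx 0 k) = lam j k.
Local Notation C := (toric_bracket Omega).

Lemma toric_aut_ext (psi1 psi2 : poissonAut C) :
  (forall f, psi1 (incl f) = psi2 (incl f)) -> psi1 = psi2.
Proof.
move=> eq_incl; apply/poissonAutP/ratfun_lrmorph_ext => k.
by rewrite -(cluster_incl_var y_cluster); apply: eq_incl.
Qed.

(** Bijectivity comes from the extension of the inverse of phi: both composites
    fix the y_k, so they are the identity. *)
Lemma extend_poissonAut (phi : poissonAut B) :
  exists psi : poissonAut C, forall f, psi (incl f) = incl (phi f).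
Proof.
have inj (chi : poissonAut B) : injective (incl \o chi).
  exact: inj_comp incl_inj (bij_inj (paut_bij chi)).
have [psi psiE] := extend_lrmorphism (inj phi).
have [psi' psi'E] := extend_lrmorphism (inj phi^-1%g).
have psi_bracket : {morph psi : f g / C f g}.
  apply: (bracket_morph (@rvar_generated K m) (@fmorph_inj _ _ psi)) => k l.
  rewrite -!(cluster_incl_var y_cluster) -!(incl_bracket OmegaE) !psiE /=.
  by rewrite paut_bracket (incl_bracket OmegaE).
have psi_bij : bijective psi.
  exists psi'.
    apply: (@ratfun_lrmorph_ext _ _ (psi' \o psi) idfun) => k.
    rewrite /= -(cluster_incl_var y_cluster) psiE /= psi'E /=.
    by congr (incl _); apply: (paut_invK phi).
  apply: (@ratfun_lrmorph_ext _ _ (psi \o psi') idfun) => k.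
  rewrite /= -(cluster_incl_var y_cluster) psi'E /= psiE /=.
  by congr (incl _); apply: (paut_Kinv phi).
by exists (PoissonAut (linearP psi) (rmorphism_monoidP psi) psi_bij psi_bracket).
Qed.

End Cluster.

Theorem proposition3p5 (K : fieldType) (charK : [pchar K] =i pred0)
    (P : comAlgType K) (B : poissonBracket P) (G : poissonGrading B)
    (m : nat) (y : 'I_m -> P) (lam : 'I_m -> 'I_m -> K)
    (incl : {lrmorphism P -> ratfun K m})
    (y_cluster : poisson_cluster B y lam incl)
    (d : 'I_m -> nat) (d_gt0 : forall k, (0 < d k)%N)
    (y_homog : forall k, G (d k) (y k))
    (Omega : bicharacter K m)
    (OmegaE : forall j k, Omega (delta_mx 0 j) (delta_mx 0 k) = lam j k) :
  exists iota : {multiplicative unipotentAut G -> poissonAut (toric_bracket Omega)},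
    [/\ injective iota,
        forall phi, unipotent_bi_integral d (iota phi)
      & forall phi : unipotentAut G,
          (forall f, iota phi (incl f) = incl (phi f)) /\
          (forall psi : poissonAut (toric_bracket Omega),
             (forall f, psi (incl f) = incl (phi f)) -> psi = iota phi)].
Proof.
have [ext extE] := boolp.choice (extend_poissonAut y_cluster OmegaE).
have ext_uniq (phi : poissonAut B) (psi : poissonAut (toric_bracket Omega)) :
    (forall f, psi (incl f) = incl (phi f)) -> psi = ext phi.
  by move=> psiE; apply: (toric_aut_ext y_cluster) => f; rewrite psiE extE.
have iotaM : {morph (fun phi : unipotentAut G => ext phi) :
    phi psi / (phi * psi)%g}.
  by move=> phi psi; apply/esym/ext_uniq => f; rewrite /= !extE.
pose iota : {multiplicative unipotentAut G -> poissonAut (toric_bracket Omega)} :=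
  HB.pack (fun phi : unipotentAut G => ext phi)
    (isMultiplicative.Build _ _ _ iotaM).
have laurent_var (phi : poissonAut B) k : laurent (ext phi (rvar K k)).
  rewrite -(cluster_incl_var y_cluster) extE.
  exact: (cluster_incl_laurent y_cluster).
exists iota; split=> [phi psi eqi|phi|phi];
  last by split=> [f|psi /ext_uniq]; rewrite ?extE.
  apply/uaut_inj/poissonAutP => f; apply: (cluster_incl_inj y_cluster).
  by rewrite -!extE -[ext phi]/(iota phi) eqi.
split=> k.
  have extV : ((ext phi)^-1)%g = ext (paut_inv phi).
    apply: ext_uniq => f; apply: (can_inj (paut_invK (ext phi))).
    by rewrite [LHS](paut_Kinv (ext phi)) extE [phi _](paut_Kinv phi).
  by rewrite [(iota phi)^-1%g]extV; split; apply: laurent_var.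
rewrite -(cluster_incl_var y_cluster) extE -rmorphB.
exact/(incl_gt y_cluster y_homog)/uautP.
Qed.
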